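(* Let $L,C_\parallel,C_\perp>0$ and let $\theta_1,\theta_2,\sigma_1,\sigma_2:[0,+\infty)\to\mathbb{R}$ be the time-dependent orientation and opening angles of two scallops. For $\lambda\in[0,1)$ and $t\in[0,+\infty)$ let $\mathcal R(t;\lambda)$ be the $6\times 6$ matrix defined in the context. Then there exists $\lambda_0\in(0,1)$ such that the matrix $\mathcal R(t;\lambda)$ is invertible for every $\lambda\in[0,\lambda_0)$ and for every $t\in[0,+\infty)$.
   Context: For $v=(a,b)^\top\in\mathbb{R}^2$ write $v^\perp=(-b,a)^\top$. For $i\in\{1,2\}$ put $\neg i=3-i$. For $i,j\in\{1,2\}$ let $$e_i^{(j)}(t)=\begin{pmatrix}\cos(\theta_i(t)+(j-1)\sigma_i(t))\\ \sin(\theta_i(t)+(j-1)\sigma_i(t))\end{pmatrix},\qquad E_i^{(j)}(t)=e_i^{(j)}(t)\otimes e_i^{(j)}(t)=e_i^{(j)}(t)\,e_i^{(j)}(t)^\top .$$ Here $e_i^{(j)}$ is the direction of the $j$-th link (of length $L$) of the $i$-th scallop, and $C_\parallel,C_\perp$ are the drag coefficients parallel and perpendicular to the links. With $I$ the $2\times2$ identity matrix, define (all quantities evaluated at $t$) $$A_i=L\big[2C_\perp I+(C_\parallel-C_\perp)(E_i^{(1)}+E_i^{(2)})\big],\qquad b_i=\frac{L^2}{2}C_\perp\big(e_i^{(1)}+e_i^{(2)}\big)^\perp,$$ $$d_i=\frac{L^2(C_\parallel-C_\perp)}{2}\Big[\big((e_i^{(1)})^\perp\cdot e_{\neg i}^{(1)}\big)e_{\neg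 i}^{(1)}+\big((e_i^{(2)})^\perp\cdot e_{\neg i}^{(2)}\big)e_{\neg i}^{(2)}\Big]+b_i,$$ $$\omega=\frac{2L^3C_\perp}{3},\qquad \varpi=\frac{L^3C_\perp}{3}\big[e_1^{(1)}\cdot e_2^{(1)}+e_1^{(2)}\cdot e_2^{(2)}\big].$$ The matrix is $$\mathcal R(t;\lambda)=\begin{pmatrix}A_1&b_1&-\lambda A_2&-\lambda b_2\\ b_1^\top&\omega&-\lambda d_1^\top&-\lambda\varpi\\ -\lambda A_1&-\lambda b_1&A_2&b_2\\ -\lambda d_2^\top&-\lambda\varpi&b_2^\top&\omega\end{pmatrix}\in\mathbb{R}^{6\times6},$$ where the block sizes (rows and columns) are $2,1,2,1$. *)

(* Defs.v *)
From HB Require Import structures.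
From mathcomp Require Import all_boot all_order all_algebra.
From mathcomp Require Import reals trigo.

Set Implicit Arguments.
Unset Strict Implicit.
Unset Printing Implicit Defensive.

Import Order.TTheory GRing.Theory Num.Theory.
Local Open Scope ring_scope.

(* Scallops i and links j, numbered 1 and 2 in the mathematics, are the elements
   0 and 1 of 'I_2: the angle theta_i + (j - 1) sigma_i becomes
   theta i + j * sigma i, and 3 - i becomes rev_ord i. *)

Definition dot {R : realType} (u v : 'cV[R]_2) : R := \sum_k u k 0 * v k 0.

Definition perp {R : realType} (v : 'cV[R]_2) : 'cV[R]_2 :=
  \col_k (if k == 0 then - v 1 0 else v 0 0).

Definition link_dir {R : realType} (theta sigma : 'I_2 -> R -> R) (t : R)
    (i j : 'I_2) : 'cV[R]_2 :=
  let phi := theta i t + (j : nat)%:R * sigma i t in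
  \col_k (if k == 0 then cos phi else sin phi).

Definition link_proj {R : realType} (theta sigma : 'I_2 -> R -> R) (t : R)
    (i j : 'I_2) : 'M[R]_2 :=
  link_dir theta sigma t i j *m (link_dir theta sigma t i j)^T.

Definition A_ {R : realType} (L Cpar Cperp : R) (theta sigma : 'I_2 -> R -> R)
    (t : R) (i : 'I_2) : 'M[R]_2 :=
  let E := link_proj theta sigma t in
  L *: ((2 * Cperp) *: 1%:M + (Cpar - Cperp) *: (E i 0 + E i 1)).

Definition b_ {R : realType} (L Cperp : R) (theta sigma : 'I_2 -> R -> R)
    (t : R) (i : 'I_2) : 'cV[R]_2 :=
  let e := link_dir theta sigma t in
  (L ^+ 2 / 2 * Cperp) *: perp (e i 0 + e i 1).

Definition d_ {R : realType} (L Cpar Cperp : R) (theta sigma : 'I_2 -> R -> R)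
    (t : R) (i : 'I_2) : 'cV[R]_2 :=
  let e := link_dir theta sigma t in
  let i' := rev_ord i in
  (L ^+ 2 * (Cpar - Cperp) / 2) *:
    (dot (perp (e i 0)) (e i' 0) *: e i' 0
     + dot (perp (e i 1)) (e i' 1) *: e i' 1)
  + b_ L Cperp theta sigma t i.

Definition omega {R : realType} (L Cperp : R) : R := 2 * L ^+ 3 * Cperp / 3.

Definition varpi {R : realType} (L Cperp : R) (theta sigma : 'I_2 -> R -> R)
    (t : R) : R :=
  let e := link_dir theta sigma t in
  L ^+ 3 * Cperp / 3 * (dot (e 0 0) (e 1 0) + dot (e 0 1) (e 1 1)).

(* The dimension 6 is written (2 + 1) + (2 + 1) to fit the block structure. *)
Definition resistance {R : realType} (L Cpar Cperp : R)
    (theta sigma : 'I_2 -> R -> R) (t lambda : R) : 'M[R]_(2 + 1 + (2 + 1)) :=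
  let A := A_ L Cpar Cperp theta sigma t in
  let b := b_ L Cperp theta sigma t in
  let d := d_ L Cpar Cperp theta sigma t in
  let om : 'M[R]_1 := (omega L Cperp)%:M in
  let vp : 'M[R]_1 := (varpi L Cperp theta sigma t)%:M in
  block_mx
    (block_mx (A 0) (b 0)
              (b 0)^T om)
    (block_mx (- lambda *: A 1) (- lambda *: b 1)
              (- lambda *: (d 0)^T) (- lambda *: vp))
    (block_mx (- lambda *: A 0) (- lambda *: b 0)
              (- lambda *: (d 1)^T) (- lambda *: vp))
    (block_mx (A 1) (b 1)
              (b 1)^T om).

(* Main.v *)
(** The matrix is M + lambda N with M block diagonal and N off-diagonal.  The
    quadratic form of each block of M is the sum over the two links of
      L Cpar p^2 + L Cperp (x^2 + x (L w) + (L w)^2 / 3),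
    with p, x the components of the velocity v along and across the link and w
    the angular velocity.  The last bracket has negative discriminant, so M is
    coercive with a constant independent of t, while the entries of N are
    bounded uniformly in t; hence M + lambda N is coercive for small lambda. *)

Require Import Defs.
From mathcomp Require Import all_boot all_order all_algebra.
From mathcomp Require Import reals trigo.
From mathcomp Require Import ring lra.
Import Order.TTheory GRing.Theory Num.Theory.
Local Open Scope ring_scope.

(** * Coercive matrices and their perturbation *)

(** Only the quadratic form enters, since the interaction blocks make the resistance matrix
    nonsymmetric. Vectors are rows to match [kermx], the left kernel. *)
Definition coercive {R : realType} {n : nat} (c : R) (M : 'M[R]_n) : Prop :=
  forall x : 'rV[R]_n, c * (\sum_i x 0 i ^+ 2) <= (x *m M *m x^T) 0 0.

Definition entries_le {R : realType} {m n : nat} (K : R) (M : 'M[R]_(m, n)) : Prop :=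
  forall i j, `|M i j| <= K.

(** Each term [x_j M_ji x_i] is at most [K (x_i^2 + x_j^2) / 2] in absolute value; over all pairs of
    indices every square is then counted [n] times. *)
Lemma entries_le_quad {R : realType} {n : nat} (K : R) (M : 'M[R]_n) (x : 'rV[R]_n) :
  0 <= K -> entries_le K M ->
  `|(x *m M *m x^T) 0 0| <= K * n%:R * (\sum_i x 0 i ^+ 2).
Proof.
move=> K0 HM.
have -> : (x *m M *m x^T) 0 0 = \sum_i \sum_j x 0 j * M j i * x 0 i.
  by rewrite mxE; apply: eq_bigr => i _; rewrite !mxE big_distrl.
have -> : K * n%:R * (\sum_i x 0 i ^+ 2) =
    \sum_(i < n) \sum_(j < n) K * ((x 0 i ^+ 2 + x 0 j ^+ 2) / 2).
  rewrite [RHS](eq_bigr (fun i => K / 2 * (n%:R * x 0 i ^+ 2 + \sum_j x 0 j ^+ 2))).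
    rewrite -big_distrr big_split /= -big_distrr /= sumr_const card_ord.
    by rewrite -[X in _ * (_ + X)]mulr_natl; field.
  move=> i _; rewrite -big_distrr -big_distrl big_split /= sumr_const card_ord.
  by rewrite -[X in X + _]mulr_natl; field.
apply: le_trans (ler_norm_sum _ _ _) _; apply: ler_sum => i _.
apply: le_trans (ler_norm_sum _ _ _) _; apply: ler_sum => j _.
rewrite !normrM -(real_normK (num_real (x 0 i))) -(real_normK (num_real (x 0 j))).
rewrite mulrAC mulrC; apply: le_trans (ler_wpM2r _ (HM j i)) _.
  by rewrite mulr_ge0.
apply: ler_wpM2l => //.
have := sqr_ge0 (`|x 0 j| - `|x 0 i|); nra.
Qed.

(** The quadratic form vanishes on the left kernel, so coercivity forces the sum of squares of a
    kernel vector to be zero. *)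
Lemma coercive_unitmx {R : realType} {n : nat} (c : R) (M : 'M[R]_n) :
  0 < c -> coercive c M -> M \in unitmx.
Proof.
move=> c0 HM; rewrite -row_free_unit -kermx_eq0.
apply/rowV0P => x /sub_kermxP xM0.
have := HM x; rewrite xM0 mul0mx mxE pmulr_rle0 // => le0.
have sq_ge0 (i : 'I_n) : true -> 0 <= x 0 i ^+ 2 by rewrite sqr_ge0.
have /eqP/(psumr_eq0P sq_ge0) x0 : \sum_i x 0 i ^+ 2 == 0.
  by rewrite eq_le le0 sumr_ge0.
by apply/rowP => i; have /eqP := x0 i isT; rewrite sqrf_eq0 mxE => /eqP.
Qed.

Lemma coercive_perturb {R : realType} {n : nat} (c K lambda : R) (M N : 'M[R]_n) :
  0 <= K -> 0 <= lambda -> coercive c M -> entries_le K N ->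
  coercive (c - lambda * (K * n%:R)) (M + lambda *: N).
Proof.
move=> K0 l0 HM HN x.
rewrite mulmxDr mulmxDl -scalemxAr -scalemxAl mulrBl mxE [X in _ <= _ + X]mxE.
apply: lerD; first exact: HM.
rewrite -mulrA -mulrN; apply: ler_wpM2l => //.
by have := entries_le_quad K N x K0 HN; rewrite ler_norml => /andP[].
Qed.

Lemma coercive_block_diag {R : realType} {m n : nat} (c : R) (M : 'M[R]_m) (N : 'M[R]_n) :
  coercive c M -> coercive c N -> coercive c (block_mx M 0 0 N).
Proof.
move=> HM HN x; rewrite -[x]hsubmxK mul_row_block !mulmx0 addr0 add0r.
rewrite tr_row_mx mul_row_col mxE big_split_ord /= mulrDr.
apply: lerD; [apply: le_trans (HM _) | apply: le_trans (HN _)] => //.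
  by under eq_bigr do rewrite row_mxEl.
by under eq_bigr do rewrite row_mxEr.
Qed.

(** * Calculus of entrywise bounds *)

Lemma entries_le_block {R : realType} {m1 m2 n1 n2 : nat} (K : R)
    (A : 'M[R]_(m1, n1)) (B : 'M[R]_(m1, n2))
    (C : 'M[R]_(m2, n1)) (D : 'M[R]_(m2, n2)) :
  entries_le K A -> entries_le K B -> entries_le K C -> entries_le K D ->
  entries_le K (block_mx A B C D).
Proof.
move=> HA HB HC HD i j; rewrite mxE.
by case: splitP => i' _; rewrite mxE; case: splitP => j' _.
Qed.

Lemma entries_le_tr {R : realType} {m n : nat} (K : R) (M : 'M[R]_(m, n)) :
  entries_le K M -> entries_le K M^T.
Proof. by move=> HM i j; rewrite mxE. Qed.

Lemma entries_leW {R : realType} {m n : nat} (K K' : R) (M : 'M[R]_(m, n)) :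
  K <= K' -> entries_le K M -> entries_le K' M.
Proof. by move=> KK' HM i j; apply: le_trans (HM i j) KK'. Qed.

Lemma entries_leD {R : realType} {m n : nat} (K K' : R) (M N : 'M[R]_(m, n)) :
  entries_le K M -> entries_le K' N -> entries_le (K + K') (M + N).
Proof.
by move=> HM HN i j; rewrite mxE; apply: le_trans (ler_normD _ _) (lerD _ _).
Qed.

Lemma entries_leZ {R : realType} {m n : nat} (a K : R) (M : 'M[R]_(m, n)) :
  entries_le K M -> entries_le (`|a| * K) (a *: M).
Proof. by move=> HM i j; rewrite mxE normrM ler_wpM2l. Qed.

Lemma entries_le_scalar {R : realType} {n : nat} (a : R) :
  entries_le `|a| (a%:M : 'M[R]_n).
Proof.
by move=> i j; rewrite mxE; case: (i == j); rewrite ?mulr1n ?mulr0n ?normr0.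
Qed.

Lemma entries_le_perp {R : realType} (K : R) (v : 'cV[R]_2) :
  entries_le K v -> entries_le K (perp v).
Proof. by move=> Hv i j; rewrite mxE; case: ifP; rewrite ?normrN. Qed.

Lemma norm_dot_le {R : realType} (K K' : R) (u v : 'cV[R]_2) :
  entries_le K u -> entries_le K' v -> `|dot u v| <= 2 * (K * K').
Proof.
move=> Hu Hv; rewrite /dot big_ord_recl big_ord1 mulr2n mulrDl mul1r.
by apply: le_trans (ler_normD _ _) (lerD _ _); rewrite normrM ler_pM.
Qed.

(** * Entry bounds uniform in time *)

Section Scallop.
Context {R : realType} {L Cpar Cperp : R} {theta sigma : 'I_2 -> R -> R}.

Lemma entries_le_link_dir t i j : entries_le 1 (link_dir theta sigma t i j).
Proof.
move=> k l; rewrite mxE.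
by case: ifP => _; rewrite ler_norml ?cos_geN1 ?cos_le1 ?sin_geN1 ?sin_le1.
Qed.

Lemma entries_le_link_proj t i j : entries_le 1 (link_proj theta sigma t i j).
Proof.
move=> k l; rewrite mxE big_ord1 [_^T _ _]mxE normrM -[1]mulr1.
by apply: ler_pM => //; apply: entries_le_link_dir.
Qed.

(** The summands come from [A_], [b_], the drag-difference part of [d_], and [varpi]; their sum
    dominates all of these at once. The factors 2 count the two links; the factors 4 count two
    links, each with a dot product of size at most 2. *)
Definition entry_bound : R :=
  (`|L| * (`|2 * Cperp| * 1 + `|Cpar - Cperp| * 2))
  + `|L ^+ 2 / 2 * Cperp| * 2
  + `|L ^+ 2 * (Cpar - Cperp) / 2| * 4
  + `|L ^+ 3 * Cperp / 3| * 4.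

Lemma entries_le_A t i : entries_le entry_bound (A_ L Cpar Cperp theta sigma t i).
Proof.
apply: (@entries_leW _ _ _ (`|L| * (`|2 * Cperp| * 1 + `|Cpar - Cperp| * (1 + 1)))).
  by rewrite /entry_bound -!addrA lerDl !addr_ge0 // mulr_ge0.
apply/entries_leZ/entries_leD; apply/entries_leZ.
  by rewrite -[X in entries_le X](@normr1 R); apply: entries_le_scalar.
by apply: entries_leD; apply: entries_le_link_proj.
Qed.

Lemma entries_le_b t i :
  entries_le (`|L ^+ 2 / 2 * Cperp| * 2) (b_ L Cperp theta sigma t i).
Proof.
apply/entries_leZ/entries_le_perp.
by apply: entries_leD; apply: entries_le_link_dir.
Qed.

Lemma entries_le_d t i :
  entries_le entry_bound (d_ L Cpar Cperp theta sigma t i).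
Proof.
apply: (@entries_leW _ _ _ (`|L ^+ 2 * (Cpar - Cperp) / 2| * (2 + 2)
    + `|L ^+ 2 / 2 * Cperp| * 2)).
  rewrite /entry_bound.
  have := normr_ge0 (L ^+ 3 * Cperp / 3).
  have := mulr_ge0 (normr_ge0 L) (normr_ge0 (2 * Cperp)).
  have := mulr_ge0 (normr_ge0 L) (normr_ge0 (Cpar - Cperp)).
  lra.
apply: entries_leD (entries_le_b t i); apply/entries_leZ.
apply: entries_leD; apply: entries_leW (entries_leZ _ _ _ (entries_le_link_dir _ _ _));
  rewrite mulr1 -[2]mulr1 -[X in 2 * X]mulr1; apply: norm_dot_le;
  try apply: entries_le_perp; exact: entries_le_link_dir.
Qed.

Lemma norm_varpi_le t : `|varpi L Cperp theta sigma t| <= `|L ^+ 3 * Cperp / 3| * 4.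
Proof.
rewrite normrM ler_wpM2l //.
have H j : `|dot (link_dir theta sigma t 0 j) (link_dir theta sigma t 1 j)| <= 2 * (1 * 1).
  by apply: norm_dot_le; apply: entries_le_link_dir.
by apply: le_trans (ler_normD _ _) _; have := H 0; have := H 1; lra.
Qed.

(** * Block splitting of the resistance matrix and coercivity of its diagonal part *)

Definition self_block t i : 'M[R]_(2 + 1) :=
  block_mx (A_ L Cpar Cperp theta sigma t i) (b_ L Cperp theta sigma t i)
    (b_ L Cperp theta sigma t i)^T (omega L Cperp)%:M.

(** The minus sign is absorbed here so that the interaction enters as [+ lambda], the form used in
    [coercive_perturb]. *)
Definition cross_block t i : 'M[R]_(2 + 1) :=
  - block_mx (A_ L Cpar Cperp theta sigma t (rev_ord i))
      (b_ L Cperp theta sigma t (rev_ord i))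
      (d_ L Cpar Cperp theta sigma t i)^T (varpi L Cperp theta sigma t)%:M.

Lemma resistanceE t lambda :
  resistance L Cpar Cperp theta sigma t lambda =
  block_mx (self_block t 0) 0 0 (self_block t 1)
  + lambda *: block_mx 0 (cross_block t 0) (cross_block t 1) 0.
Proof.
have r0 : rev_ord 0 = 1 :> 'I_2 by apply/val_inj.
have r1 : rev_ord 1 = 0 :> 'I_2 by apply/val_inj.
rewrite /resistance /self_block /cross_block r0 r1.
move: (A_ _ _ _ _ _ _ 0) (A_ _ _ _ _ _ _ 1) (b_ _ _ _ _ _ 0) (b_ _ _ _ _ _ 1) => A0 A1 b0 b1.
move: (d_ _ _ _ _ _ _ 0) (d_ _ _ _ _ _ _ 1) (omega _ _) (varpi _ _ _ _ _) => d0 d1 om vp.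
rewrite scale_block_mx !scalerN !scale_block_mx.
by rewrite add_block_mx !scaler0 !addr0 !add0r !opp_block_mx !scaleNr.
Qed.

Lemma entries_le_cross t :
  entries_le entry_bound (block_mx 0 (cross_block t 0) (cross_block t 1) 0).
Proof.
have K0 : 0 <= entry_bound.
  by rewrite /entry_bound !addr_ge0 // mulr_ge0 // addr_ge0 // mulr_ge0.
have H i : entries_le entry_bound (cross_block t i).
  move=> k l; rewrite mxE normrN; move: k l; apply: entries_le_block.
  - exact: entries_le_A.
  - apply: entries_leW (entries_le_b t _); rewrite /entry_bound.
    rewrite -addrA -addrA addrCA lerDl !addr_ge0 // ?mulr_ge0 //.
    by rewrite addr_ge0 // mulr_ge0.
  - exact/entries_le_tr/entries_le_d.
  - apply: entries_leW (entries_le_scalar _); apply: le_trans (norm_varpi_le t) _.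
    by rewrite /entry_bound lerDr !addr_ge0 // mulr_ge0 // addr_ge0 // mulr_ge0.
by apply: entries_le_block => // k l; rewrite mxE normr0.
Qed.

(* [1/16] works because [(1 - 1/16) x^2 + x y + (1/3 - 1/16) y^2] still has
   negative discriminant. *)
Lemma link_dissipation_ge (mu c s v0 v1 w : R) :
  0 < L -> 0 < mu -> mu <= Cpar -> mu <= Cperp -> c ^+ 2 + s ^+ 2 = 1 ->
  L * mu / 16 * (v0 ^+ 2 + v1 ^+ 2 + (L * w) ^+ 2) <=
  L * Cpar * (c * v0 + s * v1) ^+ 2 +
  L * Cperp * ((c * v1 - s * v0) ^+ 2 + (c * v1 - s * v0) * (L * w) + (L * w) ^+ 2 / 3).
Proof.
move=> L0 mu0 muCpar muCperp cs.
(* Passing to components along and across the link is a rotation, hence preserves the norm. *)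
have -> : v0 ^+ 2 + v1 ^+ 2 = (c * v0 + s * v1) ^+ 2 + (c * v1 - s * v0) ^+ 2.
  by rewrite -[LHS]mul1r -cs; ring.
move: (c * v0 + s * v1) (c * v1 - s * v0) (L * w) => p x y.
have Q : (x ^+ 2 + y ^+ 2) / 16 <= x ^+ 2 + x * y + y ^+ 2 / 3.
  (* Completing the square: the right side minus the left is [15/16 (x + 8/15 y)^2 + y^2 / 240]. *)
  have := sqr_ge0 (x + 8 / 15 * y); have := sqr_ge0 y; nra.
have Q0 : 0 <= x ^+ 2 + x * y + y ^+ 2 / 3.
  by apply: le_trans Q; rewrite divr_ge0 ?addr_ge0 ?sqr_ge0.
rewrite -!mulrA -mulrDr ler_pM2l //.
have := ler_wpM2r (sqr_ge0 p) muCpar; have := ler_wpM2r Q0 muCperp.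
have := ler_wpM2l (ltW mu0) Q; have := mulr_ge0 (ltW mu0) (sqr_ge0 p); lra.
Qed.

(** Two links contribute [L * mu / 16] each, with [mu] the smaller drag coefficient. They control
    [(L w)^2] rather than [w^2], whence the minimum of [1] and [L ^+ 2]. *)
Definition coercivity : R := L * Num.min Cpar Cperp / 8 * Num.min 1 (L ^+ 2).

Lemma self_block_coercive t i : 0 < L -> 0 < Cpar -> 0 < Cperp ->
  coercive coercivity (self_block t i).
Proof.
move=> L0 Cpar0 Cperp0 x.
set mu := Num.min Cpar Cperp.
have mu0 : 0 < mu by rewrite lt_min Cpar0.
have mu1 : mu <= Cpar by rewrite ge_min lexx.
have mu2 : mu <= Cperp by rewrite ge_min lexx orbT.
rewrite -[x]hsubmxK; move: (lsubmx x) (rsubmx x) => v w.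
rewrite mul_row_block tr_row_mx mul_row_col big_split_ord /= big_ord1.
under eq_bigr do rewrite row_mxEl.
rewrite row_mxEr.
rewrite !big_ord_recl !big_ord0 /=.
rewrite /A_ /b_ /omega /link_proj /perp.
do 3! rewrite !mxE !big_ord_recl !big_ord0 /=.
rewrite !mxE /=.
move: (theta i t + 0 * _) => a0; move: (theta i t + _ * _) => a1.
have cs (a : R) : cos a ^+ 2 + sin a ^+ 2 = 1 by apply: cos2Dsin2.
move: (cos a0) (sin a0) (cos a1) (sin a1) (cs a0) (cs a1) => {cs} p0 q0 p1 q1 cs0 cs1.
move: (v 0 ord0) (v 0 (lift ord0 ord0)) (w 0 ord0) => v0 v1 y.
have H0 := link_dissipation_ge mu p0 q0 v0 v1 y L0 mu0 mu1 mu2 cs0.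
have H1 := link_dissipation_ge mu p1 q1 v0 v1 y L0 mu0 mu1 mu2 cs1.
set Q := (X in _ <= X).
(* The subtracted term is zero because the link directions are unit vectors. It replaces [2 I] in
   [A_] by the sum of their squared lengths, after which equality with the sum of the two link forms
   is a polynomial identity. *)
have -> : Q = Q - L * Cperp * (2 - (p0 ^+ 2 + q0 ^+ 2) - (p1 ^+ 2 + q1 ^+ 2))
                    * (v0 ^+ 2 + v1 ^+ 2).
  by rewrite cs0 cs1; ring.
apply: le_trans (le_trans _ (lerD H0 H1)) _; last first.
  by rewrite le_eqVlt; apply/orP; left; apply/eqP; rewrite /Q; field.
have -> : coercivity = (L * mu / 16) * 2 * Num.min 1 (L ^+ 2).
  by rewrite /coercivity -/mu; field.
rewrite -mulrDr -!mulrA ler_pM2l // ler_pM2l //.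
have m1 : Num.min 1 (L ^+ 2) <= 1 by rewrite ge_min lexx.
have m2 : Num.min 1 (L ^+ 2) <= L ^+ 2 by rewrite ge_min lexx orbT.
have := ler_wpM2r (sqr_ge0 v0) m1; have := ler_wpM2r (sqr_ge0 v1) m1.
have := ler_wpM2r (sqr_ge0 y) m2; rewrite -exprMn; lra.
Qed.

End Scallop.

Theorem theorem1 (R : realType) (L Cpar Cperp : R)
    (hL : 0 < L) (hCpar : 0 < Cpar) (hCperp : 0 < Cperp)
    (theta sigma : 'I_2 -> R -> R) :
  exists lambda0 : R, 0 < lambda0 < 1 /\
    forall lambda : R, 0 <= lambda < lambda0 ->
    forall t : R, 0 <= t ->
      resistance L Cpar Cperp theta sigma t lambda \in unitmx.
Proof.
set c := @coercivity R L Cpar Cperp; set K := @entry_bound R L Cpar Cperp.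
have c0 : 0 < c.
  by rewrite !mulr_gt0 // ?lt_min ?hCpar ?invr_gt0 // ltr01 exprn_gt0.
(* Strictness comes from the term [2 * Cperp] of [A_], positive even when the two drag coefficients
   agree; it yields [lambda0 < 1]. *)
have K0 : 0 < K.
  rewrite /K /entry_bound -!addrA ltr_wpDr //.
    by rewrite !addr_ge0 // mulr_ge0.
  rewrite mulr_gt0 ?normr_gt0 ?gt_eqF // ltr_wpDr ?mulr_ge0 //.
  by rewrite mulr1 normr_gt0 gt_eqF // mulr_gt0.
have cK0 : 0 < c + K * 6 by rewrite addr_gt0 // mulr_gt0.
(* The perturbed constant [c - lambda * (K * 6)], with 6 the dimension, must be positive. The extra
   [c] in the denominator keeps the ratio below 1, and [lambda * (K * 6) <= lambda * (c + K * 6) <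
   c] still holds. *)
exists (c / (c + K * 6)); split.
  by rewrite divr_gt0 //= ltr_pdivrMr // mul1r ltrDl mulr_gt0.
move=> lambda /andP[l0 l1] t _; rewrite resistanceE.
apply: (@coercive_unitmx _ _ (c - lambda * (K * 6))); last first.
  apply: coercive_perturb => //; first exact: ltW.
    by apply: coercive_block_diag; apply: self_block_coercive.
  exact: entries_le_cross.
move: l1; rewrite ltr_pdivlMr // subr_gt0; apply: le_lt_trans.
by rewrite ler_wpM2l // lerDr ltW.
Qed.
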